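(* Let $A=(a_1\ \cdots\ a_n)\in\mathbb Z^{1\times n}$ be a matrix of positive integers whose toric ideal $I_A$ is a complete intersection. If some minimal Markov basis of $A$ reduces the distance of the circuits of $A$, then $A$ admits a gluing of the first kind, i.e., there is a permutation $\sigma$ of $\{1,\dots,n\}$ such that for each $k\in\{1,\dots,n-1\}$ there exists $x\in\mathbb N\{a_{\sigma(1)},\dots,a_{\sigma(k)}\}\cap a_{\sigma(k+1)}\mathbb N$ with $x\mathbb Z=\mathbb Z\{a_{\sigma(1)},\dots,a_{\sigma(k)}\}\cap a_{\sigma(k+1)}\mathbb Z$.
   Context: $\mathbb NX$ and $\mathbb ZX$ denote the semigroup and the group generated by a set $X$ of integers. For $z\in\mathbb Z^n$, $z^+,z^-\in\mathbb N^n$ are the unique vectors with disjoint supports and $z=z^+-z^-$; $\|\cdot\|$ is the $1$-norm. The toric ideal is $I_A=\langle x^{u^+}-x^{u^-}:u\in\ker(A)\rangle$; it is a complete intersection if generated by $\dim\ker(A)$ elements. A Markov basis is a set $B\subseteq\ker(A)$ whose binomials $x^{u^+}-x^{u^-}$ generate $I_A$; minimal means no proper subset is a Markov basis. For nonzero $z\in\ker(A)$, $u\in\ker(A)$ reduces the distance of $z$ if there exist $(p,q)\in\{(z^+,z^-),(z^-,z^+)\}$ and $\varepsilon\in\{\pm1\}$ with $p+\varepsilon u\in\mathbb N^n$ and $\|p+\varepsilon u-q\|<\|z\|$; $B$ reduces the distance of $Z$ if each nonzero $z\in Z$ has its distance reduced by some element of $B$. A circuit is a nonzero element of $\ker(A)$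 with support of size exactly two. *)

(* Defs.v *)
From mathcomp Require Import all_boot all_order all_algebra all_fingroup.
From mathcomp Require Import mpoly.
Set Implicit Arguments. Unset Strict Implicit. Unset Printing Implicit Defensive.
Import Order.TTheory GRing.Theory Num.Theory.
Local Open Scope ring_scope.

(* A 1 x n integer matrix A = (a_1 ... a_n) is represented by a : 'I_n -> nat. *)

Definition intvec (n : nat) := {ffun 'I_n -> int}.

Definition in_ker (n : nat) (a : 'I_n -> nat) (u : intvec n) : Prop :=
  \sum_(i < n) (a i)%:Z * u i = 0.

Definition vpos (n : nat) (z : intvec n) (i : 'I_n) : nat :=
  if 0 <= z i then `|z i|%N else 0%N.
Definition vneg (n : nat) (z : intvec n) (i : 'I_n) : nat :=
  if z i < 0 then `|z i|%N else 0%N.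

Definition norm1 (n : nat) (v : 'I_n -> int) : nat := (\sum_(i < n) `|v i|%N)%N.

Definition monom (k : fieldType) (n : nat) (v : 'I_n -> nat) : {mpoly k[n]} :=
  'X_[ [multinom v i | i < n] ].
Definition binom (k : fieldType) (n : nat) (u : intvec n) : {mpoly k[n]} :=
  monom k (vpos u) - monom k (vneg u).

Definition in_ideal (R : comNzRingType) (S : R -> Prop) (p : R) : Prop :=
  exists (s : seq (R * R)), (forall c, c \in s -> S c.2) /\
    p = \sum_(c <- s) c.1 * c.2.

Definition toric_ideal (k : fieldType) (n : nat) (a : 'I_n -> nat)
  : {mpoly k[n]} -> Prop :=
  in_ideal (fun f => exists u : intvec n, in_ker a u /\ f = binom k u).

Arguments toric_ideal k {n} a _.

(* dim ker(A) = n - 1 for A a nonzero 1 x n matrix (all a_i > 0) *)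
Definition complete_intersection (k : fieldType) (n : nat) (a : 'I_n -> nat)
  : Prop :=
  exists gens : seq {mpoly k[n]}, size gens = n.-1 /\
    forall p, in_ideal (fun f => f \in gens) p <-> toric_ideal k a p.

Arguments complete_intersection k {n} a.

Definition markov_basis (k : fieldType) (n : nat) (a : 'I_n -> nat)
  (B : intvec n -> Prop) : Prop :=
  (forall u, B u -> in_ker a u) /\
  forall p, in_ideal (fun f => exists u, B u /\ f = binom k u) p <->
            toric_ideal k a p.

Arguments markov_basis k {n} a B.

Definition minimal_markov_basis (k : fieldType) (n : nat) (a : 'I_n -> nat)
  (B : intvec n -> Prop) : Prop :=
  markov_basis k a B /\
  forall B' : intvec n -> Prop, (forall u, B' u -> B u) ->
    (exists u, B u /\ ~ B' u) -> ~ markov_basis k a B'.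

Arguments minimal_markov_basis k {n} a B.

Definition reduces_distance (n : nat) (u z : intvec n) : Prop :=
  exists (pq : ('I_n -> nat) * ('I_n -> nat)) (e : int),
    (pq = (vpos z, vneg z) \/ pq = (vneg z, vpos z)) /\
    (e = 1 \/ e = -1) /\
    (forall i, (0 <= (pq.1 i)%:Z + e * u i)%R) /\
    (norm1 (fun i => ((pq.1 i)%:Z + e * u i - (pq.2 i)%:Z)%R) < norm1 z)%N.

Definition reduces_distance_of (n : nat) (B Z : intvec n -> Prop) : Prop :=
  forall z, Z z -> z != 0 -> exists2 u, B u & reduces_distance u z.

Definition circuit (n : nat) (a : 'I_n -> nat) (z : intvec n) : Prop :=
  in_ker a z /\ z != 0 /\ #|[set i | z i != 0]| = 2%N.

Definition in_semigroup (n : nat) (a : 'I_n -> nat) (S : {set 'I_n}) (x : int)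
  : Prop :=
  exists c : 'I_n -> nat, x = \sum_(i in S) ((c i * a i)%N)%:Z.
Definition in_group (n : nat) (a : 'I_n -> nat) (S : {set 'I_n}) (y : int)
  : Prop :=
  exists c : 'I_n -> int, y = \sum_(i in S) c i * (a i)%:Z.

(* gluing of the first kind (0-based indices: sigma(0),...,sigma(n-1));      *)
(* for 1 <= k <= n-1 the set {sigma(j) : j < k} and the next index sigma(k). *)
Definition first_kind_gluing (n : nat) (a : 'I_n -> nat) : Prop :=
  exists s : 'S_n, forall j : 'I_n, (0 < val j)%N ->
    let S := [set s i | i : 'I_n & (val i < val j)%N] in
    exists x : nat,
      in_semigroup a S x%:Z /\ (a (s j) %| x)%N /\
      forall y : int, (x%:Z %| y)%Z <-> (in_group a S y /\ ((a (s j))%:Z %| y)%Z).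

(* Main.v *)
Require Import Defs.
From HB Require Import structures.
From Stdlib Require Import ClassicalEpsilon.
From mathcomp Require Import all_boot all_order all_algebra all_fingroup.
From mathcomp Require Import mpoly zify ring.
Set Implicit Arguments. Unset Strict Implicit. Unset Printing Implicit Defensive.
Import Order.TTheory GRing.Theory Num.Theory.
Local Open Scope ring_scope.

(** A minimal Markov basis B of a complete intersection has at most n - 1
    elements (graded Nakayama). If u in B reduces the distance of the circuit
    a_j e_i - a_i e_j, then u = ±(c e_i - v) or u = ±(c e_j - v) with v >= 0: i,
    respectively j, is a head of u. A vector with two heads is itself a circuit,
    and attaching it to the head of smaller [a] (ties broken by index) still
    serves one index of every pair, because the other orientation of the vector
    shortens no circuit but the one through both of its heads. Hence all
    indices except one, r, are heads of distinct elements f i of B, and these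
    exhaust B.

    The digraph sending i to the other indices in the support of f i is acyclic:
    a set C in which every i has a successor could be enlarged to a proper set Z
    such that every element of B meets Z in both signs or not at all, and then
    the 0/1 point vanishing exactly on Z would be a zero of the toric ideal. A
    topological order makes B triangular, and since B spans ker(A) over the
    integers, its diagonal entries give the required gluings. *)

(** * Ideals *)

Lemma in_ideal0 (R : comNzRingType) (S : R -> Prop) : in_ideal S 0.
Proof. by exists [::]; split=> [c|]; rewrite ?big_nil ?in_nil. Qed.

Lemma in_ideal_gen (R : comNzRingType) (S : R -> Prop) (f : R) :
  S f -> in_ideal S f.
Proof.
move=> Sf; exists [:: (1, f)]; split=> [c|]; last by rewrite big_seq1 mul1r.
by rewrite inE => /eqP->.
Qed.

Lemma in_idealD (R : comNzRingType) (S : R -> Prop) (p q : R) :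
  in_ideal S p -> in_ideal S q -> in_ideal S (p + q).
Proof.
move=> [s [Ss ->]] [t [St ->]]; exists (s ++ t); split; last by rewrite big_cat.
by move=> c; rewrite mem_cat => /orP[/Ss|/St].
Qed.

Lemma in_idealMl (R : comNzRingType) (S : R -> Prop) (r p : R) :
  in_ideal S p -> in_ideal S (r * p).
Proof.
move=> [s [Ss ->]]; exists [seq (r * c.1, c.2) | c <- s]; split.
  by move=> c /mapP[d /Ss Sd ->].
by rewrite big_map mulr_sumr; apply: eq_bigr => c _; rewrite mulrA.
Qed.

Lemma in_ideal_sum (R : comNzRingType) (S : R -> Prop) (I : Type) (s : seq I)
    (P : pred I) (F : I -> R) :
  (forall i, P i -> in_ideal S (F i)) -> in_ideal S (\sum_(i <- s | P i) F i).
Proof.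
move=> SF; apply: (big_ind (in_ideal S)) => //; first exact: in_ideal0.
by move=> p q; apply: in_idealD.
Qed.

Lemma in_ideal_ind (R : comNzRingType) (S P : R -> Prop) :
  P 0 -> (forall p q, P p -> P q -> P (p + q)) ->
  (forall r f, S f -> P (r * f)) -> forall p, in_ideal S p -> P p.
Proof.
move=> P0 PD PM p [s [Ss ->]].
by rewrite big_seq; apply: (big_ind P) => // c /Ss; apply: PM.
Qed.

Lemma in_ideal_trans (R : comNzRingType) (S T : R -> Prop) (p : R) :
  (forall f, S f -> in_ideal T f) -> in_ideal S p -> in_ideal T p.
Proof.
move=> ST; elim/in_ideal_ind; first exact: in_ideal0.
  by move=> q r; apply: in_idealD.
by move=> r f /ST; apply: in_idealMl.
Qed.

(** Merging all occurrences of a generator leaves one coefficient per index, so that the constant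
    terms of these coefficients can later form a matrix. *)
Lemma in_ideal_seq (R : comNzRingType) (gens : seq R) (p : R) :
  in_ideal (fun f => f \in gens) p ->
  exists q : 'I_(size gens) -> R, p = \sum_j q j * gens`_j.
Proof.
elim/in_ideal_ind.
- by exists (fun=> 0); rewrite big1 // => j _; rewrite mul0r.
- move=> _ _ [q1 ->] [q2 ->]; exists (fun j => q1 j + q2 j).
  by rewrite -big_split /=; apply: eq_bigr => j _; rewrite mulrDl.
- move=> r f /[dup] gf; rewrite -index_mem => lf.
  exists (fun j => if j == Ordinal lf then r else 0).
  rewrite (bigD1 (Ordinal lf)) //= eqxx nth_index // big1 ?addr0 //.
  by move=> j /negPf->; rewrite mul0r.
Qed.

(** * Graded pieces of binomial ideals *)

(** The projection onto the span of the monomials satisfying [P]; below, [P] singles out a degree or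
    a lattice coset. *)
Definition mfilter (k : fieldType) (n : nat) (P : pred 'X_{1..n})
    (p : {mpoly k[n]}) : {mpoly k[n]} :=
  \sum_(m <- msupp p | P m) p@_m *: 'X_[m].

Lemma mcoeff_filter (k : fieldType) (n : nat) (P : pred 'X_{1..n})
    (p : {mpoly k[n]}) m :
  (mfilter P p)@_m = if P m then p@_m else 0.
Proof.
rewrite /mfilter raddf_sum /=.
have [mp|mNp] := boolP (m \in msupp p); last first.
  rewrite (memN_msupp_eq0 mNp) if_same big_seq_cond big1 // => m' /andP[m'p _].
  rewrite mcoeffZ mcoeffX; case: eqP m'p mNp => [->->//|]; by rewrite mulr0.
rewrite big_mkcond (bigD1_seq m) ?msupp_uniq //= big1 ?addr0.
  by case: (P m); rewrite ?mcoeff0 // mcoeffZ mcoeffX eqxx mulr1.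
by move=> m' /negPf m'm; case: (P m') => //; rewrite mcoeffZ mcoeffX m'm mulr0.
Qed.

Lemma mfilter_is_linear (k : fieldType) (n : nat) (P : pred 'X_{1..n}) :
  linear (@mfilter k n P).
Proof.
move=> c p q; apply/mpolyP => m.
by rewrite !(mcoeffD, mcoeffZ, mcoeff_filter); case: ifP; rewrite ?mulr0 ?addr0.
Qed.

HB.instance Definition _ (k : fieldType) (n : nat) (P : pred 'X_{1..n}) :=
  GRing.isLinear.Build k {mpoly k[n]} {mpoly k[n]} _ (@mfilter k n P)
    (@mfilter_is_linear k n P).

Lemma mfilterX (k : fieldType) (n : nat) (P : pred 'X_{1..n}) m :
  mfilter P 'X_[m] = if P m then 'X_[m] else 0 :> {mpoly k[n]}.
Proof.
apply/mpolyP => m'; rewrite mcoeff_filter mcoeffX.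
case: eqP => [<-|ne]; case: ifP; rewrite ?mcoeffX ?mcoeff0 ?eqxx //.
- by case: ifP => _ //; rewrite ?mcoeffX ?mcoeff0 //; case: eqP ne.
- by case: ifP => _ //; rewrite ?mcoeffX ?mcoeff0 //; case: eqP ne.
Qed.

Definition mpos (n : nat) (u : intvec n) : 'X_{1..n} := [multinom vpos u i | i < n].
Definition mneg (n : nat) (u : intvec n) : 'X_{1..n} := [multinom vneg u i | i < n].

(** By hypothesis the two monomials of each product of a monomial with the binomial are kept or
    dropped together. *)
Lemma mfilter_mul_binom (k : fieldType) (n : nat) (P : pred 'X_{1..n})
    (u : intvec n) (q : {mpoly k[n]}) :
  (forall m, P (m + mpos u)%MM = P (m + mneg u)%MM) ->
  mfilter P (q * binom k u) =
  mfilter (fun m => P (m + mpos u)%MM) q * binom k u.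
Proof.
move=> Pu; rewrite {1}[q]mpolyE mulr_suml raddf_sum /= [in RHS]/mfilter mulr_suml.
rewrite [RHS]big_mkcond; apply: eq_bigr => m _.
rewrite /binom /monom -/(mpos u) -/(mneg u) -scalerAl linearZ /= mulrBr.
rewrite -!mpolyXD raddfB /= !mfilterX -Pu; case: ifP => // _.
by rewrite subrr scaler0.
Qed.

(** The grading with $\deg x_i = a_i$, for which the toric ideal is homogeneous. *)
Definition weight (n : nat) (a : 'I_n -> nat) (m : 'X_{1..n}) : nat :=
  (\sum_i a i * m i)%N.

Lemma weightD (n : nat) (a : 'I_n -> nat) (m m' : 'X_{1..n}) :
  weight a (m + m')%MM = (weight a m + weight a m')%N.
Proof. by rewrite -big_split /=; apply: eq_bigr => i _; rewrite mnmDE mulnDr. Qed.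

Lemma weight_eq0 (n : nat) (a : 'I_n -> nat) (m : 'X_{1..n}) :
  (forall i, 0 < a i)%N -> weight a m = 0%N -> m = 0%MM.
Proof.
move=> a_gt0 /eqP; rewrite sum_nat_eq0 => /forallP m0; apply/mnmP => i.
by move: (m0 i); rewrite muln_eq0 mnm0E; have := a_gt0 i; case: (a i) => //= ? _ /eqP.
Qed.

Lemma vpos_sub_vneg (n : nat) (u : intvec n) i :
  (vpos u i)%:Z - (vneg u i)%:Z = u i.
Proof. by rewrite /vpos /vneg; case: ltP; lia. Qed.

Lemma weight_mpos (n : nat) (a : 'I_n -> nat) (u : intvec n) :
  in_ker a u -> weight a (mpos u) = weight a (mneg u).
Proof.
move=> ku; apply/eqP; rewrite -eqz_nat -subr_eq0 /weight -!natz !natr_sum -sumrB.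
apply/eqP; rewrite -[RHS]ku; apply: eq_bigr => i _.
by rewrite !mnmE !natz !PoszM -mulrBr vpos_sub_vneg.
Qed.

(* Graded Nakayama: n distinct elements of B and n - 1 generators of I give a
   k-linear combination of n binomials lying in m I; its component of degree
   [weight a (mpos (g i0))] expresses the i0-th binomial through the others. *)
Lemma minimal_markov_card (k : fieldType) (n : nat) (a : 'I_n -> nat)
    (B : intvec n -> Prop) (g : 'I_n -> intvec n) :
  (0 < n)%N -> (forall i, 0 < a i)%N -> complete_intersection k a ->
  minimal_markov_basis k a B -> injective g -> ~ (forall i, B (g i)).
Proof.
move=> n_gt0 a_gt0 [gens [szg gensP]] [[Bker BP] Bmin] g_inj Bg.
have genB u : B u -> in_ideal (fun f => f \in gens) (binom k u).
  by move=> Bu; apply/gensP/BP/in_ideal_gen; exists u.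
have [Q QP] := fin_all_exists (fun i => in_ideal_seq (genB _ (Bg i))).
pose M := \matrix_(i, j) (Q i j)@_0%MM.
have /rowV0Pn[c /sub_kermxP cM c0] : kermx M != 0.
  rewrite -mxrank_eq0 mxrank_ker; rewrite subn_eq0 -ltnNge.
  by apply: leq_ltn_trans (rank_leq_col M) _; rewrite szg; case: (n) n_gt0.
have [i0 ci0] : exists i, c 0 i != 0.
  by have /rV0Pn := c0.
set d := weight a (mpos (g i0)); pose wd m := weight a m == d.
pose B' u := B u /\ u <> g i0.
pose S' f := exists u, B' u /\ f = binom k u.
have wdB u : B u -> forall m, wd (m + mpos u)%MM = wd (m + mneg u)%MM.
  by move=> /Bker/weight_mpos wu m; rewrite /wd !weightD wu.
have filt p : in_ideal (fun f => exists u, B u /\ f = binom k u) p ->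
    forall r, r@_0%MM = 0 -> in_ideal S' (mfilter wd (r * p)).
  elim/in_ideal_ind => [r _|p1 p2 H1 H2 r r0|r' f [u [Bu ->]] r r0].
  - by rewrite mulr0 raddf0; apply: in_ideal0.
  - by rewrite mulrDr raddfD; apply: in_idealD; [apply: H1|apply: H2].
  rewrite mulrA mfilter_mul_binom; last exact: wdB.
  have [ug|ug] := eqVneq u (g i0); last first.
    by apply/in_idealMl/in_ideal_gen; exists u; split=> //; split=> //; apply/eqP.
  (* In degree [d] a multiplier of the [i0]-th binomial has weight 0, so it is constant; but
     [r * r'] has no constant term. *)
  suff -> : mfilter (fun m => wd (m + mpos u)%MM) (r * r') = 0.
    by rewrite mul0r; apply: in_ideal0.
  apply/mpolyP => m; rewrite mcoeff_filter mcoeff0; case: ifP => // /eqP.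
  rewrite weightD ug -/d => /eqP; rewrite -[X in _ == X]add0n eqn_add2r => /eqP.
  by move=> /(weight_eq0 a_gt0)->; rewrite rmorphM /= r0 mul0r.
have comb : \sum_i c 0 i *: binom k (g i) =
    \sum_j (\sum_i c 0 i *: Q i j) * gens`_j.
  under eq_bigr => i _ do rewrite QP scaler_sumr.
  rewrite exchange_big; apply: eq_bigr => j _ /=; rewrite mulr_suml.
  by apply: eq_bigr => i _; rewrite scalerAl.
have filtB i : mfilter wd (binom k (g i)) =
    mfilter (fun m => wd (m + mpos (g i))%MM) 1 * binom k (g i).
  by rewrite -[in LHS](mul1r (binom _ _)) mfilter_mul_binom //; apply: wdB.
have : in_ideal S' (mfilter wd (\sum_i c 0 i *: binom k (g i))).
  rewrite comb raddf_sum; apply: in_ideal_sum => j _; apply: filt.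
    by apply/BP/gensP/in_ideal_gen/mem_nth.
  (* The constant term of this coefficient is an entry of [c *m M]. *)
  rewrite raddf_sum /=; have /matrixP/(_ 0 j) := cM.
  by rewrite !mxE => e; rewrite -[RHS]e; apply: eq_bigr => i _; rewrite mcoeffZ mxE.
(* The [i0]-th binomial is homogeneous of degree [d], so the filter keeps it whole; the other terms
   are multiples of binomials of [B']. *)
rewrite (bigD1 i0) //= linearD linearZ /= filtB.
rewrite -(mpolyX0 n) mfilterX add0m /wd eqxx mpolyX0 mul1r.
move=> /in_idealD/(_ (in_idealMl (-1) _)) H.
have {H} gi0 : in_ideal S' (binom k (g i0)).
  rewrite -[binom _ _](scalerK ci0) -mul_mpolyC; apply: in_idealMl.
  rewrite -[_ *: _](addrK (mfilter wd (\sum_(i < n | i != i0) c 0 i *: binom k (g i)))).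
  rewrite -[X in _ + X]mulN1r; apply: H.
  rewrite linear_sum; apply: in_ideal_sum => i ii0; rewrite linearZ /= filtB.
  rewrite -mul_mpolyC; apply/in_idealMl/in_idealMl/in_ideal_gen.
  exists (g i); split=> //; split=> //; move/g_inj => e; by rewrite e eqxx in ii0.
apply: (Bmin B') => [u []//| |]; first by exists (g i0); split=> // -[].
split=> [u [/Bker]//|p]; split=> [|/BP].
  move=> H; apply/BP; move: H; apply: in_ideal_trans => f [u [[Bu _] ->]].
  by apply: in_ideal_gen; exists u.
apply: in_ideal_trans => f [u [Bu ->]].
have [->//|ug] := eqVneq u (g i0).
by apply: in_ideal_gen; exists u; split=> //; split=> //; apply/eqP.
Qed.

(** * The lattice spanned by a Markov basis *)

Definition mvec (n : nat) (m : 'X_{1..n}) : intvec n := [ffun i => (m i)%:Z].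

Lemma mvecD (n : nat) (m m' : 'X_{1..n}) : mvec (m + m')%MM = mvec m + mvec m'.
Proof. by apply/ffunP => i; rewrite !ffunE mnmDE PoszD. Qed.

Lemma mvec_sub (n : nat) (u : intvec n) : mvec (mpos u) - mvec (mneg u) = u.
Proof. by apply/ffunP => i; rewrite !ffunE !mnmE vpos_sub_vneg. Qed.

(* The sum of the coefficients over one coset of L vanishes on the ideal
   generated by the binomials of B. *)
Lemma markov_span (k : fieldType) (n : nat) (a : 'I_n -> nat)
    (B L : intvec n -> Prop) (z : intvec n) :
  markov_basis k a B -> L 0 -> (forall u v, L u -> L v -> L (u - v)) ->
  (forall u, B u -> L u) -> in_ker a z -> L z.
Proof.
move=> [Bker BP] L0 LB BL kz.
have LN u : L u -> L (- u) by move=> Lu; rewrite -sub0r; apply: LB.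
have LD u v : L u -> L v -> L (u + v).
  by move=> Lu Lv; rewrite -[v]opprK; apply/LB/LN.
(* The coset of $z^+$ modulo [L], made decidable by classical logic. *)
pose P m : bool := excluded_middle_informative (L (mvec m - mvec (mpos z))).
have PP m : reflect (L (mvec m - mvec (mpos z))) (P m).
  by rewrite /P; case: excluded_middle_informative => ?; constructor.
have Pinv u : B u -> forall m, P (m + mpos u)%MM = P (m + mneg u)%MM.
  move=> Bu m; have e : mvec (m + mpos u)%MM - mvec (mpos z) =
      mvec (m + mneg u)%MM - mvec (mpos z) + u.
    rewrite !mvecD -[X in _ = _ + X]mvec_sub; apply/ffunP => i.
    by rewrite !ffunE; ring.
  apply/PP/PP; rewrite e => H; last by apply: LD => //; apply: BL.
  by rewrite -[mvec _ - _](addrK u); apply: LB => //; apply: BL.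
have ev0 p : in_ideal (fun f => exists u, B u /\ f = binom k u) p ->
    (mfilter P p).@[fun=> 1] = 0.
  elim/in_ideal_ind => [|p1 p2 H1 H2|r f [u [Bu ->]]].
  - by rewrite raddf0 meval0.
  - by rewrite raddfD mevalD H1 H2 addr0.
  rewrite mfilter_mul_binom; last exact: Pinv.
  rewrite mevalM /binom mevalB !mevalX !big1 ?subrr ?mulr0 // => i _;
    exact: expr1n.
have /BP/ev0 : toric_ideal k a (binom k z) by apply: in_ideal_gen; exists z.
rewrite /binom /monom raddfB /= !mfilterX -/(mpos z) -/(mneg z).
(* If $z^-$ lay outside the coset of $z^+$, the filtered binomial would take the value 1 at the
   all-ones point. *)
have -> : P (mpos z) by apply/PP; rewrite subrr.
rewrite mevalB mevalX big1 => [|i _]; last exact: expr1n.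
case: PP => [/LN|_ /eqP]; first by rewrite opprB mvec_sub.
by rewrite meval0 subr0 oner_eq0.
Qed.

(** * Heads of kernel vectors *)

(** Up to sign, $u = c e_i - v$ with $c > 0$ and $v \ge 0$ zero at $i$; products of entries cover
    both signs at once. *)
Definition is_head (n : nat) (i : 'I_n) (u : intvec n) : bool :=
  (u i != 0) && [forall j, (j != i) ==> (u i * u j <= 0)].

(* An injective refinement of the order of the values [a i]. *)
Definition key (n : nat) (a : 'I_n -> nat) (i : 'I_n) : nat := (a i * n + i)%N.

Definition main_head (n : nat) (a : 'I_n -> nat) (i : 'I_n) (u : intvec n) : bool :=
  is_head i u && [forall j, is_head j u ==> (key a i <= key a j)%N].

Lemma key_inj (n : nat) (a : 'I_n -> nat) : injective (key a).
Proof.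
move=> i j /(congr1 (modn^~ n)).
by rewrite /key !modnMDl !modn_small ?ltn_ord //; apply: val_inj.
Qed.

Lemma main_head_inj (n : nat) (a : 'I_n -> nat) (i j : 'I_n) (u : intvec n) :
  main_head a i u -> main_head a j u -> i = j.
Proof.
move=> /andP[hi /forallP mi] /andP[hj /forallP mj]; apply: (@key_inj _ a).
by apply/eqP; rewrite eqn_leq (implyP (mi j)) ?(implyP (mj i)).
Qed.

Lemma key_le (n : nat) (a : 'I_n -> nat) (i j : 'I_n) :
  (key a i <= key a j)%N -> (a i <= a j)%N.
Proof. by rewrite /key => H; have := ltn_ord j; nia. Qed.

(** Two heads have opposite signs, and any third entry is weakly opposite to both. *)
Lemma two_heads (n : nat) (i j : 'I_n) (u : intvec n) :
  is_head i u -> is_head j u -> i != j ->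
  forall l, l != i -> l != j -> u l = 0.
Proof.
move=> /andP[ui /forallP hi] /andP[uj /forallP hj] ij l li lj.
have := implyP (hi j); rewrite eq_sym => /(_ ij).
have := implyP (hi l) li; have := implyP (hj l) lj.
by move: (u i) (u j) (u l) ui uj => x y t x0 y0 *; nia.
Qed.

Lemma kernel_mixed (n : nat) (a : 'I_n -> nat) (u : intvec n) i :
  (forall i, 0 < a i)%N -> in_ker a u -> 0 < u i -> exists j, u j < 0.
Proof.
move=> a_gt0 ku ui; apply/existsP; apply: contraT; rewrite negb_exists.
move=> /forallP un; have : 0 < \sum_(j < n) (a j)%:Z * u j.
  rewrite (bigD1 i) //=; apply: ltr_wpDr; last by rewrite mulr_gt0 ?ltz_nat.
  by apply: sumr_ge0 => j _; rewrite mulr_ge0 // leNgt.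
by rewrite ku ltxx.
Qed.

Lemma is_headE (n : nat) (i j : 'I_n) (u : intvec n) :
  is_head i u -> j != i -> u i * u j <= 0.
Proof. by move=> /andP[_ /forallP/(_ j)/implyP]; apply. Qed.

(** Here $p = a_j e_i$ moves to $p + eu \ge 0$, so $eu$ can be negative only at $i$, which is thus a
    head. If another head $l$ has a smaller key, shortening forces $l = j$. *)
Lemma reduction_main_head (n : nat) (a : 'I_n -> nat) (i j : 'I_n)
    (u : intvec n) (e : int) :
  (forall i, 0 < a i)%N -> in_ker a u -> i != j -> e = 1 \/ e = -1 ->
  (forall l, 0 <= (if l == i then (a j)%:Z else 0) + e * u l) ->
  (Defs.norm1 (fun l => ((if l == i then (a j)%:Z else 0) + e * u l
                    - (if l == j then (a i)%:Z else 0))%R) < a i + a j)%N ->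
  main_head a i u \/ main_head a j u.
Proof.
move=> a_gt0 ku ij e1 pos; have ji : j != i by rewrite eq_sym.
have posN l : l != i -> 0 <= e * u l.
  by move=> /negPf li; have := pos l; rewrite li add0r.
have posi : 0 <= (a j)%:Z + e * u i by have := pos i; rewrite eqxx.
rewrite /Defs.norm1 (bigD1 i) //= (bigD1 j) //= !eqxx (negPf ij) (negPf ji) => red.
(* Otherwise $eu \ge 0$ everywhere; positivity of the $a_m$ gives $u = 0$, and the distance stays
   the same. *)
have ui : e * u i < 0.
  rewrite ltNge; apply/negP => ui.
  have u0 l : e * u l = 0.
    have nn m : true -> 0 <= (a m)%:Z * (e * u m).
      move=> _; apply: mulr_ge0 => //.
      by have [->|/posN] := eqVneq m i.
    have : \sum_m (a m)%:Z * (e * u m) == 0.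
      rewrite (eq_bigr (fun m => e * ((a m)%:Z * u m))); last by move=> *; ring.
      by rewrite -mulr_sumr ku mulr0.
    rewrite psumr_eq0 // => /allP/(_ l (mem_index_enum _)) /eqP.
    by have := a_gt0 l; nia.
  by move: red; rewrite !u0; lia.
have hi : is_head i u.
  apply/andP; split; first by apply/eqP => u0; rewrite u0 mulr0 ltxx in ui.
  apply/forallP => l; apply/implyP => /posN; move: ui.
  by case: e1 => ->; nia.
have [|/forallPn[l]] := boolP [forall l, is_head l u ==> (key a i <= key a l)%N].
  by move=> mi; left; apply/andP.
rewrite negb_imply -ltnNge => /andP[hl lti].
have li : l != i by apply/eqP => li; rewrite li ltnn in lti.
have il : i != l by rewrite eq_sym.
have supp := two_heads hi hl il.
have [lj|lj] := eqVneq l j.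
  right; subst l; apply/andP; split=> //; apply/forallP => m; apply/implyP.
  have [->|mi] := eqVneq m i; first by move=> _; apply: ltnW.
  have [->//|mj] := eqVneq m j.
  by move=> /andP[]; rewrite supp.
have al : (a l <= a i)%N by apply/key_le/ltnW.
have eqk : (a i)%:Z * u i + (a l)%:Z * u l = 0.
  rewrite -[RHS]ku (bigD1 i) //= (bigD1 l) //= big1 ?addr0 //.
  by move=> m /andP[mi ml]; rewrite supp ?mulr0.
have uj : u j = 0 by rewrite supp // eq_sym.
have uli := posN _ li.
move: red; rewrite (bigD1 l) ?li //= (negPf li) (negPf lj) uj.
(* As $a_l \le a_i$, the entry at $l$ grows by at least what the entry at $i$ loses. The target is 0
   at $l \ne j$, so the distance does not drop. *)
have le_u : - (e * u i) <= e * u l.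
  have := a_gt0 l; have := a_gt0 i.
  have : (a i)%:Z * (e * u i) + (a l)%:Z * (e * u l) = 0.
    by rewrite !(mulrCA _ e) -mulrDr eqk mulr0.
  by move: (e * u i) (e * u l) ui uli => x y *; nia.
by move: (e * u i) (e * u l) ui uli le_u posi => x y *; lia.
Qed.

(** * Circuits through two given indices *)

Definition pair_circuit (n : nat) (a : 'I_n -> nat) (i j : 'I_n) : intvec n :=
  [ffun l => if l == i then (a j)%:Z else if l == j then - (a i)%:Z else 0].

Lemma pair_circuit_ker (n : nat) (a : 'I_n -> nat) (i j : 'I_n) :
  i != j -> in_ker a (pair_circuit a i j).
Proof.
move=> ij; have ji : j != i by rewrite eq_sym.
rewrite /in_ker (bigD1 i) //= (bigD1 j) //= big1 => [|l /andP[li lj]].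
  by rewrite !ffunE !eqxx (negPf ji); ring.
by rewrite ffunE (negPf li) (negPf lj) mulr0.
Qed.

Lemma vpos_pair_circuit (n : nat) (a : 'I_n -> nat) (i j l : 'I_n) :
  (forall i, 0 < a i)%N -> i != j ->
  vpos (pair_circuit a i j) l = if l == i then a j else 0%N.
Proof.
move=> a_gt0 ij; rewrite /vpos ffunE; have := a_gt0 i.
by case: (l == i) => //; case: (l == j) => //; case: leP; lia.
Qed.

Lemma vneg_pair_circuit (n : nat) (a : 'I_n -> nat) (i j l : 'I_n) :
  (forall i, 0 < a i)%N -> i != j ->
  vneg (pair_circuit a i j) l = if l == j then a i else 0%N.
Proof.
move=> a_gt0 ij; rewrite /vneg ffunE; have := a_gt0 i.
have [->|_] := eqVneq l i; first by rewrite (negPf ij).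
by case: (l == j) => //; case: ltP; lia.
Qed.

Lemma pair_main_head (n : nat) (a : 'I_n -> nat) (B : intvec n -> Prop)
    (i j : 'I_n) :
  (forall i, 0 < a i)%N -> (forall u, B u -> in_ker a u) ->
  reduces_distance_of B (circuit a) -> i != j ->
  exists2 u, B u & main_head a i u \/ main_head a j u.
Proof.
move=> a_gt0 Bker red ij; set z := pair_circuit a i j.
have ji : j != i by rewrite eq_sym.
have supp : [set l | z l != 0] = [set i; j].
  apply/setP => l; rewrite !inE ffunE; have := a_gt0 i; have := a_gt0 j.
  by case: (l == i); case: (l == j) => //=; lia.
have z0 : z != 0.
  apply/eqP => z0; have : i \in [set l | z l != 0] by rewrite supp !inE eqxx.
  by rewrite inE z0 ffunE eqxx.
have cz : circuit a z.
  by split; [exact: pair_circuit_ker|split=> //; rewrite supp cards2 ij].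
have normz : Defs.norm1 z = (a i + a j)%N.
  rewrite /Defs.norm1 (bigD1 i) //= (bigD1 j) //= big1 => [|l /andP[li lj]].
    by rewrite !ffunE !eqxx (negPf ji); lia.
  by rewrite ffunE (negPf li) (negPf lj).
have [u Bu [pq [e [pqE [e1 [pos]]]]]] := red _ cz z0.
rewrite normz => lt; exists u => //; have ku := Bker _ Bu.
case: pqE pos lt => -> /= pos lt.
  apply: (@reduction_main_head _ _ _ _ _ e) => //.
    move=> l; have := pos l; rewrite vpos_pair_circuit //; by case: eqP.
  apply: leq_ltn_trans lt; apply: eq_leq; apply: eq_bigr => l _.
  by rewrite vpos_pair_circuit ?vneg_pair_circuit //; do 2!case: ifP.
(* The other orientation starts from $a_i e_j$: the roles of [i] and [j] are exchanged. *)
apply/or_comm; apply: (@reduction_main_head _ _ _ _ _ e) => //.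
  by move=> l; have := pos l; rewrite vneg_pair_circuit //; case: eqP.
rewrite addnC; apply: leq_ltn_trans lt; apply: eq_leq; apply: eq_bigr => l _.
by rewrite vpos_pair_circuit ?vneg_pair_circuit //; do 2!case: ifP.
Qed.

(** * Triangular Markov bases *)

Definition meets_pos (n : nat) (Z : {set 'I_n}) (u : intvec n) : bool :=
  [exists l in Z, 0 < u l].
Definition meets_neg (n : nat) (Z : {set 'I_n}) (u : intvec n) : bool :=
  [exists l in Z, u l < 0].

Lemma meets_posP (n : nat) (Z : {set 'I_n}) (u : intvec n) :
  reflect (exists2 l, l \in Z & 0 < u l) (meets_pos Z u).
Proof. exact: exists_inP. Qed.

Lemma meets_negP (n : nat) (Z : {set 'I_n}) (u : intvec n) :
  reflect (exists2 l, l \in Z & u l < 0) (meets_neg Z u).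
Proof. exact: exists_inP. Qed.

(** Since $0^0 = 1$, a monomial vanishes at this point exactly when its support meets [Z]. *)
Lemma meval_indicator (k : fieldType) (n : nat) (Z : {set 'I_n})
    (w : 'I_n -> nat) :
  (monom k w).@[fun l => (l \notin Z)%:R] =
  (~~ [exists l in Z, 0 < w l]%N)%:R.
Proof.
rewrite mevalX; case: existsP => [[l /andP[lZ wl]]|nZ] /=.
  rewrite (bigD1 l) //= mnmE lZ expr0n; by case: (w l) wl => //=; rewrite mul0r.
apply: big1 => l _; rewrite mnmE; have [lZ|_] := boolP (l \in Z).
  by have [->//|wl] := posnP (w l); case: nZ; exists l; rewrite lZ.
exact: expr1n.
Qed.

Lemma meval_binom_indicator (k : fieldType) (n : nat) (Z : {set 'I_n})
    (u : intvec n) :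
  (binom k u).@[fun l => (l \notin Z)%:R] =
  (~~ meets_pos Z u)%:R - (~~ meets_neg Z u)%:R.
Proof.
rewrite mevalB !meval_indicator; congr ((~~ _)%:R - (~~ _)%:R);
  apply: eq_existsb => l; congr (_ && _); rewrite /vpos /vneg;
  case: (ltP (u l) 0); lia.
Qed.

(* The point with coordinates 0 on Z and 1 elsewhere would be a zero of the
   toric ideal, but x_i^{a_j} - x_j^{a_i} does not vanish there. *)
Lemma markov_separates (k : fieldType) (n : nat) (a : 'I_n -> nat)
    (B : intvec n -> Prop) (Z : {set 'I_n}) (i j : 'I_n) :
  (forall i, 0 < a i)%N -> markov_basis k a B -> i \in Z -> j \notin Z ->
  ~ (forall u, B u -> meets_pos Z u = meets_neg Z u).
Proof.
move=> a_gt0 [_ BP] iZ jZ closedZ.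
have ij : i != j by apply/eqP => ij; rewrite -ij iZ in jZ.
have /BP : toric_ideal k a (binom k (pair_circuit a i j)).
  by apply: in_ideal_gen; exists (pair_circuit a i j); split=> //; exact: pair_circuit_ker.
have ev0 p : in_ideal (fun f => exists u, B u /\ f = binom k u) p ->
    p.@[fun l => (l \notin Z)%:R] = 0.
  elim/in_ideal_ind => [|p1 p2 H1 H2|r f [u [/closedZ Zu ->]]].
  - by rewrite meval0.
  - by rewrite mevalD H1 H2 addr0.
  - by rewrite mevalM meval_binom_indicator Zu subrr mulr0.
move=> /ev0 /eqP; rewrite meval_binom_indicator.
have -> : meets_pos Z (pair_circuit a i j).
  by apply/existsP; exists i; rewrite iZ ffunE eqxx ltz_nat a_gt0.
have -> : meets_neg Z (pair_circuit a i j) = false.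
  apply/existsP => -[l /andP[lZ]]; rewrite ffunE.
  case: (l == i) => //; case: eqP => [lj|//].
  by rewrite lj (negPf jZ) in lZ.
by rewrite sub0r oppr_eq0 oner_eq0.
Qed.

(* Otherwise C meets both signs of at least #|C| vectors [f i]. Enlarging C one
   index at a time keeps this inequality, until every [f i] meets both or none
   of its signs; since there are only n - 1 vectors, this set is proper. *)
Lemma heads_acyclic (k : fieldType) (n : nat) (a : 'I_n -> nat)
    (B : intvec n -> Prop) (r : 'I_n) (f : 'I_n -> intvec n) (C : {set 'I_n}) :
  (forall i, 0 < a i)%N -> markov_basis k a B ->
  (forall u, B u -> exists2 i, i != r & u = f i) ->
  (forall i, i != r -> B (f i)) -> (forall i, i != r -> is_head i (f i)) ->
  C != set0 -> r \notin C ->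
  exists2 i, i \in C & forall j, j \in C -> j != i -> f i j = 0.
Proof.
move=> a_gt0 MB Bf fB fh C0 rC.
have [/exists_inP[i iC /forall_inP fi]|noi] :=
    boolP [exists i in C, [forall j in C, (j != i) ==> (f i j == 0)]].
  by exists i => // j jC ji; apply/eqP/(implyP (fi j jC)).
pose mix Z := [set i | [&& i != r, meets_pos Z (f i) & meets_neg Z (f i)]].
pose Q (Z : {set 'I_n}) := (Z != set0) && (#|Z| <= #|mix Z|)%N.
have QC : Q C.
  rewrite /Q C0; apply/subset_leq_card/subsetP => i iC; rewrite inE.
  have ir : i != r by apply/eqP => ir; rewrite -ir iC in rC.
  (* The head [i] and a further nonzero entry of [f i] in [C] have opposite signs, so [i] belongs to
     [mix C]. *)
  move: noi; rewrite negb_exists_in => /forall_inP/(_ _ iC).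
  rewrite negb_forall_in => /exists_inP[j jC]; rewrite negb_imply => /andP[ji fj].
  have := is_headE (fh _ ir) ji; have /andP[fi _] := fh _ ir.
  rewrite ir /= => le0; apply/andP.
  have [pi|ni] : 0 < f i i \/ f i i < 0 by lia.
    by split; apply/exists_inP; [exists i => //|exists j => //]; nia.
  by split; apply/exists_inP; [exists j => //|exists i => //]; nia.
case: (@arg_maxnP _ C Q (fun Z => #|Z|) QC) => Z /andP[Z0 cZ] Zmax.
have [i iZ] := set0Pn _ Z0.
have [j jZ] : exists j, j \notin Z.
  apply/existsP; apply: contraT; rewrite negb_exists => /forallP ZT.
  (* [mix Z] misses [r], so it cannot have [n] elements. *)
  have ZE : Z = setT by apply/setP => l; have := ZT l; rewrite inE negbK.
  move: cZ; rewrite {1}ZE cardsT leqNgt => /negP; case.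
  rewrite -cardsT; apply/proper_card/properP; split; first exact: subsetT.
  by exists r; rewrite !inE ?eqxx.
exfalso; apply: (markov_separates a_gt0 MB iZ jZ) => _ /Bf[l lr ->].
(* Adding [m] never shrinks [mix Z]; if it brought in [l], the larger set would still satisfy [Q],
   against maximality. *)
have grow m : m \notin Z -> l \notin mix Z -> l \notin mix (m |: Z).
  move=> mZ lZ; apply/negP => lmZ.
  have sub : mix Z \subset mix (m |: Z).
    apply/subsetP => t; rewrite !inE => /and3P[-> /meets_posP[x xZ xt] /meets_negP[y yZ yt]].
    apply/and3P; split=> //; [apply/meets_posP; exists x|apply/meets_negP; exists y] => //;
      by rewrite !inE ?xZ ?yZ orbT.
  have /Zmax : Q (m |: Z).
    rewrite /Q -card_gt0 cardsU1 mZ /=; apply: leq_ltn_trans cZ _.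
    by apply/proper_card/properP; split=> //; exists l.
  by rewrite cardsU1 mZ /= add1n ltnn.
have kf := (proj1 MB) _ (fB _ lr).
apply/idP/idP => [/[dup] mp /meets_posP[x xZ px]|/[dup] mn /meets_negP[x xZ px]].
  (* The missing sign occurs at some [m] outside [Z], and adding this [m] brings [l] into [mix],
     against [grow]. *)
  apply: contraT => mn; have [m nm] := kernel_mixed a_gt0 kf px.
  have mZ : m \notin Z.
    by apply: contra mn => mZ; apply/exists_inP; exists m.
  have := grow m mZ; rewrite !inE (negPf mn) lr mp => /(_ isT).
  case/negP; apply/and3P; split=> //; [apply/meets_posP; exists x|apply/meets_negP; exists m] => //.
    by rewrite !inE xZ orbT.
  by rewrite !inE eqxx.
apply: contraT => mp.
(* The same argument for the opposite sign, applied to [- f l]. *)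
have kNf : in_ker a (- f l).
  rewrite /in_ker; under eq_bigr => t _ do rewrite ffunE mulrN.
  by rewrite sumrN kf oppr0.
have pNx : 0 < (- f l) x by rewrite ffunE oppr_gt0.
have [m] := kernel_mixed a_gt0 kNf pNx.
rewrite ffunE oppr_lt0 => nm.
have mZ : m \notin Z.
  by apply: contra mp => mZ; apply/exists_inP; exists m.
have := grow m mZ; rewrite !inE (negPf mp) lr => /(_ isT).
case/negP; apply/and3P; split=> //; [apply/meets_posP; exists m|apply/meets_negP; exists x] => //.
  by rewrite !inE eqxx.
by rewrite !inE xZ orbT.
Qed.

Lemma acyclic_order (n : nat) (e : rel 'I_n) (r : 'I_n) :
  (forall C : {set 'I_n}, C != set0 -> r \notin C ->
     exists2 i, i \in C & forall j, j \in C -> j != i -> ~~ e i j) ->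
  exists s : 'S_n, (forall j : 'I_n, val j = 0%N -> s j = r) /\
    forall j i : 'I_n, (0 < j < i)%N -> ~~ e (s j) (s i).
Proof.
move=> acyc.
have build m : (m < n)%N -> exists t : seq 'I_n,
    [/\ size t = m.+1, uniq t, nth r t 0 = r &
      forall j l, (0 < j < m.+1)%N -> l \notin take j.+1 t -> ~~ e (nth r t j) l].
  elim: m => [_|m IHm mn].
    by exists [:: r]; split=> // j l; case: j.
  have [t [szt ut t0 tP]] := IHm (ltnW mn).
  have rt : r \in t by rewrite -t0 mem_nth ?szt.
  have C0 : [set i | i \notin t] != set0.
    apply/eqP => C0; move: mn; rewrite ltnNge -szt -[X in (X <= _)%N]card_ord cardE.
    move=> /negP; case; apply: uniq_leq_size (enum_uniq _) _ => i _.
    by have /setP/(_ i) := C0; rewrite !inE => /negbFE.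
  have [|i] := acyc _ C0; first by rewrite inE negbK.
  rewrite inE => it iP; exists (rcons t i); split.
  - by rewrite size_rcons szt.
  - by rewrite rcons_uniq it.
  - by rewrite nth_rcons szt.
  move=> j l /andP[j0]; rewrite ltnS leq_eqVlt => /orP[/eqP->|jm].
    rewrite take_oversize ?size_rcons ?szt // mem_rcons inE negb_or => /andP[li lt].
    by rewrite nth_rcons szt ltnn eqxx; apply: iP; rewrite ?inE.
  rewrite -cats1 takel_cat ?szt // nth_cat szt jm; apply: tP.
  by rewrite j0.
have n_gt0 : (0 < n)%N := leq_ltn_trans (leq0n _) (ltn_ord r).
have [t [szt ut t0 tP]] := build n.-1 (ltac:(by rewrite ltn_predL)).
rewrite prednK // in szt tP.
have s_inj : injective (fun j : 'I_n => nth r t j).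
  move=> i j /eqP; rewrite nth_uniq ?szt ?ltn_ord // => /eqP; exact: val_inj.
exists (perm s_inj); split=> [j j0|j i /andP[j0 ji]]; rewrite !permE /=.
  by move: j0 => /= ->.
apply: tP; first by rewrite j0 /=.
apply/negP => /(nthP r)[m]; rewrite size_takel ?szt ?ltn_ord // => mj.
have mi := leq_trans mj ji.
rewrite nth_take // => /eqP; rewrite nth_uniq ?szt ?ltn_ord //.
  by move=> /eqP mi'; rewrite mi' ltnn in mi.
exact: ltn_trans mi (ltn_ord i).
Qed.

(** [f (s j)] lives on the first [j + 1] indices of the order, so it writes a multiple of [a (s j)]
    through the earlier values. Triangularity of the spanning family shows that its diagonal entry
    is the smallest such multiplier. *)
Lemma triangular_gluing (n : nat) (a : 'I_n -> nat) (r : 'I_n)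
    (f : 'I_n -> intvec n) (s : 'S_n) :
  (forall i, i != r -> in_ker a (f i)) ->
  (forall i, i != r -> is_head i (f i)) ->
  (forall j : 'I_n, val j = 0%N -> s j = r) ->
  (forall j i : 'I_n, (0 < j < i)%N -> f (s j) (s i) = 0) ->
  (forall z, in_ker a z -> exists c : 'I_n -> int,
     z = \sum_(i | i != r) [ffun l => c i * f i l]) ->
  first_kind_gluing a.
Proof.
move=> fker fh s0 tri span; exists s => j j_gt0 S.
have sr (i : 'I_n) : (0 < i)%N -> s i != r.
  move=> i_gt0; have z : (0 < n)%N by apply: leq_trans (ltn_ord i).
  rewrite -(s0 (Ordinal z)) //; apply/eqP => /perm_inj e.
  by rewrite e in i_gt0.
have Ssi i : (s i \in S) = (i < j)%N.
  apply/imsetP/idP => [[i']|ij]; last by exists i; rewrite ?inE.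
  by rewrite inE => lt /perm_inj->.
have sjS : s j \notin S by rewrite Ssi ltnn.
have fS l : l \notin S -> l != s j -> f (s j) l = 0.
  rewrite -[l](permKV s) Ssi -leqNgt => le ne; apply: tri; rewrite j_gt0 /=.
  by rewrite ltn_neqAle le andbT; apply: contra ne => /eqP/val_inj->.
set c := `|f (s j) (s j)|%N; have head := fh _ (sr _ j_gt0).
(* The kernel equation of [f (s j)]: all other entries are weakly opposite to the head, so absolute
   values turn it into a semigroup relation. *)
have relj : (c * a (s j))%N%:Z = \sum_(i in S) (`|f (s j) i| * a i)%N%:Z.
  have := fker _ (sr _ j_gt0); rewrite /in_ker (bigD1 (s j)) //= (bigID (mem S)) /=.
  rewrite [X in _ + (_ + X)]big1 ?addr0; last first.
    by move=> l /andP[ls lS]; rewrite fS ?mulr0.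
  have -> : \sum_(i < n | (i != s j) && (i \in S)) (a i)%:Z * f (s j) i =
      \sum_(i in S) (a i)%:Z * f (s j) i.
    by apply: eq_bigl => i; case: eqP => //= ->; rewrite (negPf sjS).
  have Sj i : i \in S -> i != s j by apply: contraTneq => ->.
  have [ps|ns] : 0 < f (s j) (s j) \/ f (s j) (s j) < 0.
    by case/andP: head => ? _; lia.
  - move/eqP; rewrite addr_eq0 => /eqP eqj.
    rewrite PoszM mulrC /c (gtz0_abs ps) eqj -sumrN; apply: eq_bigr => i /Sj ij.
    have le0 : f (s j) i <= 0 by have := is_headE head ij; nia.
    by rewrite PoszM lez0_abs //; ring.
  - move/eqP; rewrite addr_eq0 -eqr_oppLR => /eqP eqj.
    rewrite PoszM mulrC /c (ltz0_abs ns) mulrN eqj; apply: eq_bigr => i /Sj ij.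
    have ge0 : 0 <= f (s j) i by have := is_headE head ij; nia.
    by rewrite PoszM gez0_abs //; ring.
exists (c * a (s j))%N; split; last split.
- by exists (fun i => `|f (s j) i|%N); rewrite relj.
- exact: dvdn_mull.
move=> y; split=> [/dvdzP[t ->]|[[d yd] /dvdzP[t yt]]].
  split; last by rewrite PoszM mulrA; apply: dvdz_mull.
  exists (fun i => t * `|f (s j) i|%N%:Z); rewrite relj mulr_sumr.
  by apply: eq_bigr => i _; rewrite PoszM mulrA.
(* The two expressions of [y], as $t\,a_{s(j)}$ and as a combination over [S], differ by a kernel
   vector. *)
pose z : intvec n := [ffun i => if i == s j then t else if i \in S then - d i else 0].
have kz : in_ker a z.
  rewrite /in_ker (bigD1 (s j)) //= (bigID (mem S)) /=.
  rewrite [X in _ + (_ + X)]big1 ?addr0; last first.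
    by move=> l /andP[/negPf ls /negPf lS]; rewrite ffunE ls lS mulr0.
  rewrite ffunE eqxx mulrC -yt yd; apply/eqP; rewrite addr_eq0 -sumrN; apply/eqP.
  under [RHS]eq_bigl => i.
    have -> : (i != s j) && (i \in S) = (i \in S).
      by case: eqP => //= ->; rewrite (negPf sjS).
    over.
  apply: eq_bigr => i iS; rewrite ffunE iS.
  have /negPf-> : i != s j by apply: contraTneq iS => ->.
  by ring.
have [b zb] := span _ kz.
have evz l : z l = \sum_(i < n | s i != r) b (s i) * f (s i) l.
  rewrite {1}zb sum_ffunE (reindex_inj (@perm_inj _ s)) /=.
  by apply: eq_bigr => i _; rewrite ffunE.
have pos_of i : s i != r -> (0 < i)%N.
  by rewrite lt0n; apply: contra => /eqP/s0/eqP.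
(* Descending induction on [i]: at coordinate [s i], where [z] is 0, only the term with nonzero
   diagonal entry survives. *)
have b0 : forall i : 'I_n, (j < i)%N -> b (s i) = 0.
  suff H m (i : 'I_n) : (n - i < m)%N -> (j < i)%N -> b (s i) = 0.
    by move=> i; apply: (H (n - i).+1).
  elim: m i => // m IHm i lim ji.
  have : z (s i) = 0.
    rewrite ffunE Ssi [(i < j)%N]ltnNge (ltnW ji) /=; case: eqP => // /perm_inj e.
    by rewrite e ltnn in ji.
  have i_gt0 : (0 < i)%N by apply: leq_ltn_trans ji.
  rewrite evz (bigD1 i) ?sr //= big1 ?addr0 => [/eqP|i' /andP[i'r i'i]].
    by rewrite mulf_eq0 => /orP[/eqP//|]; case/andP: (fh _ (sr _ i_gt0)) => /negPf->.
  have [lt|gt|e] := ltngtP i' i; last by rewrite (val_inj e) eqxx in i'i.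
    by rewrite tri ?mulr0 // pos_of.
  by rewrite IHm ?mul0r //; [have := ltn_ord i'; lia|apply: ltn_trans gt].
have : z (s j) = b (s j) * f (s j) (s j).
  rewrite evz (bigD1 j) ?sr //= big1 ?addr0 // => i /andP[ir ij].
  have [lt|gt|e] := ltngtP i j; last by rewrite (val_inj e) eqxx in ij.
    by rewrite tri ?mulr0 // pos_of.
  by rewrite b0 ?mul0r.
rewrite ffunE eqxx => tE; rewrite yt PoszM; apply: dvdz_mul => //.
by rewrite tE; apply: dvdz_mull; rewrite /c dvdzE.
Qed.

Theorem theorem5p1 (k : fieldType) (n : nat) (a : 'I_n -> nat) :
  (forall i, (0 < a i)%N) ->
  complete_intersection k a ->
  (exists B, minimal_markov_basis k a B /\ reduces_distance_of B (circuit a)) ->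
  first_kind_gluing a.
Proof.
move=> a_gt0 CI [B [minB red]]; have [[Bker BP] _] := minB.
have [n0|n_gt0] := posnP n.
  by exists 1%g => j; suff: (j < 0)%N by []; rewrite -n0 ltn_ord.
pose hd i := exists2 u, B u & main_head a i u.
have hd2 i j : i != j -> hd i \/ hd j.
  by move=> /(pair_main_head a_gt0 Bker red)[u Bu [h|h]]; [left|right]; exists u.
have [r rP] : exists r, forall i, i != r -> hd i.
  have [[r nr]|all] := classic (exists r, ~ hd r).
    by exists r => i /hd2[].
  (* If every index is a main head, any index may serve as [r]. *)
  by exists (Ordinal n_gt0) => i _; apply: NNPP => nh; apply: all; exists i.
have /fin_all_exists[f fP] i : exists u, i != r -> B u /\ main_head a i u.
  have [->|/rP[u Bu hu]] := eqVneq i r; first by exists 0.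
  by exists u.
have fB i : i != r -> B (f i) by case/fP.
have fh i : i != r -> is_head i (f i) by case/fP => _ /andP[].
have f_inj i j : i != r -> j != r -> f i = f j -> i = j.
  move=> /fP[_ hi] /fP[_ hj] e; rewrite e in hi; exact: main_head_inj hi hj.
have Bf u : B u -> exists2 i, i != r & u = f i.
  move=> Bu; apply: NNPP => nf.
  (* An element [u] outside the family fills the slot [r], giving [n] distinct elements of [B]. *)
  pose g i := if i == r then u else f i.
  apply: (@minimal_markov_card k n a B g) => // [i j|i]; rewrite /g.
    have [->|ir] := eqVneq i r; have [->|jr] := eqVneq j r => // e.
    - by case: nf; exists j.
    - by case: nf; exists i.
    - exact: f_inj.
  by case: eqVneq => [//|/fB].
have [s [s0 tri]] : exists s : 'S_n, (forall j : 'I_n, val j = 0%N -> s j = r) /\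
    forall j i : 'I_n, (0 < j < i)%N -> ~~ (f (s j) (s i) != 0).
  apply: (@acyclic_order n (fun i j => f i j != 0)) => C C0 rC.
  have [i iC iP] := heads_acyclic a_gt0 (conj Bker BP) Bf fB fh C0 rC.
  by exists i => // j jC ji; rewrite iP ?eqxx.
apply: (triangular_gluing (f := f) (s := s) _ fh s0).
- by move=> i /fB/Bker.
- by move=> j i /tri; rewrite negbK => /eqP.
(* The integer span of the [f i] contains [B], hence the whole kernel. *)
pose L (z : intvec n) := exists c : 'I_n -> int,
  z = \sum_(i | i != r) [ffun l => c i * f i l].
move=> z; apply: (@markov_span k n a B L z (conj Bker BP)).
- exists (fun=> 0); rewrite big1 // => i _.
  by apply/ffunP => l; rewrite !ffunE mul0r.
- move=> _ _ [c1 ->] [c2 ->]; exists (fun i => c1 i - c2 i).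
  rewrite -sumrB; apply: eq_bigr => i _.
  by apply/ffunP => l; rewrite !ffunE mulrBl.
- move=> u /Bf[i ir ->]; exists (fun l => (l == i)%:R).
  rewrite (bigD1 i) //= big1 ?addr0 => [|l /andP[_ /negPf li]].
    by apply/ffunP => l; rewrite ffunE eqxx mul1r.
  by apply/ffunP => m; rewrite !ffunE li mul0r.
Qed.
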